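(* Let $n\ge1$ and let $(F_\mu(z))_\mu$ be a family of polynomials in $z=(z_1,\ldots,z_n)$ indexed by compositions $\mu$ of length $n$, with $F_{(0,\ldots,0)}(z)=1$, for which there are known formulas computing, for every composition $\mu$ and every $i\in\{1,\ldots,n-1\}$, $F_{s_i\mu}(z)$ and $F_{\Phi\mu}(z)$ from $F_\mu(z)$ and $\mu$; that is, maps $U_1,\ldots,U_{n-1},V$ taking a polynomial and a composition to a polynomial, such that $U_i(F_\mu,\mu)=F_{s_i\mu}$ and $V(F_\mu,\mu)=F_{\Phi\mu}$ for all $\mu$ and $i$. Let $\eta$ be a composition of length $n$, let ${\rm R}(\eta)=({\rm R}(\eta)_1,\ldots,{\rm R}(\eta)_N)$ be the sequence defined in the context, and let $N=|{\rm R}(\eta)|$ be its length. For a polynomial $f$, a composition $\mu$ and $i\in\{0,1,\ldots,n-1\}$ define $${\rm RG}(f,\mu,i):=\begin{cases}\{U_i(f,\mu),\,s_i\mu\}, & i=1,\ldots,n-1,\\ \{V(f,\mu),\,\Phi\mu\}, & i=0,\end{cases}$$ where the output is an ordered pair, so that ${\rm RG}(F_\mu,\mu,i)=\{F_{s_i\mu},s_i\mu\}$ for $i\geq 1$ and ${\rm RG}(F_\mu,\mu,0)=\{F_{\Phi\mu},\Phi\mu\}$. Start with the polynomial $1$ and the composition $(0,\ldots,0)$, and for $j=1,2,\ldots,N$ successively replace the current polynomial $f$ and composition $\mu$ by the pair ${\rm RG}(f,\mu,{\rm R}(\eta)_j)$. Then after $N=|{\rm R}(\eta)|$ steps the polynomial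 obtained is $F_\eta(z)$.
   Context: A composition is an $n$-tuple $\eta=(\eta_1,\ldots,\eta_n)$ of non-negative integers; $\max(\eta)$ is its largest component. The switching operators act on compositions by $s_i(\eta_1,\ldots,\eta_i,\eta_{i+1},\ldots,\eta_n):=(\eta_1,\ldots,\eta_{i+1},\eta_i,\ldots,\eta_n)$ for $i=1,\ldots,n-1$, and the raising operator acts by $\Phi\eta:=(\eta_2,\ldots,\eta_n,\eta_1+1)$. Let $\eta^+$ be the rearrangement of $\eta$ in nonincreasing order, and for a composition $\mu$ let $\mu^R:=(\mu_n,\ldots,\mu_1)$. The families $F_\mu$ intended include the nonsymmetric and interpolation Macdonald polynomials, the nonsymmetric and interpolation Jack polynomials, and the generalised nonsymmetric Hermite and Laguerre polynomials (coefficients lie in the appropriate field of parameters). Definition of ${\rm R}(\eta)$: it is a finite sequence of elements of $\{0,1,\ldots,n-1\}$ encoding, in order of application, a sequence of operators transforming $(0,\ldots,0)$ to $\eta$, where $0$ stands for $\Phi$ and $i\in\{1,\ldots,n-1\}$ stands for $s_i$. Explicitly, put $l_{\eta,i}:=\#\{j:\eta_j<i\}$ and $g_{\eta,i}:=\#\{j:\eta_j\ge i\}$. For $i\ge2$ let $$\sigma(\eta,i):=(l_{\eta,i-1},\ldots,1,\;l_{\eta,i-1}+1,\ldots,2,\;\ldots,\;l_{\eta,i-1}+g_{\eta,i}-1,\ldots,g_{\eta,i}),$$ the concatenation, for $m=1,\ldots,g_{\eta,i}$ in this order, of the decreasing lists $l_{\eta,i-1}+m-1,\ldots,m$ (each of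 length $l_{\eta,i-1}$, empty if $l_{\eta,i-1}=0$); let $\sigma(\eta,1)$ be the empty list. For a list $(i_1,\ldots,i_l)$ put $s_{(i_1,\ldots,i_l)}:=s_{i_l}\cdots s_{i_1}$ ($s_{i_1}$ applied first; the empty list gives the identity). Recursively for $i=n,n-1,\ldots,2$ define $$p_{\eta,i}:=\max\Big\{j\le i:\ \big(s_{\sigma'(\eta,i+1)}\cdots s_{\sigma'(\eta,n)}(\eta^+)^R\big)_j=\eta_i\Big\}$$ and let $\sigma'(\eta,i)$ be the list $(p_{\eta,i},p_{\eta,i}+1,\ldots,i-1)$ if $p_{\eta,i}<i$, and the empty list if $p_{\eta,i}=i$. Then ${\rm R}(\eta)$ is the concatenation of: for $i=1,2,\ldots,\max(\eta)$ in this order, the list $\sigma(\eta,i)$ followed by $g_{\eta,i}$ zeros; and then the lists $\sigma'(\eta,n),\sigma'(\eta,n-1),\ldots,\sigma'(\eta,2)$ in this order. For example ${\rm R}((4,1,2,1))=(0,0,0,0,0,0,2,1,0,3,2,1,0,2,3,2,1)$. *)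

(* Defs.v *)
From HB Require Import structures.
From mathcomp Require Import all_boot all_order all_algebra.
From mathcomp Require Import mpoly.
Set Implicit Arguments.
Unset Strict Implicit.
Unset Printing Implicit Defensive.
Local Open Scope nat_scope.

(* A composition is an n-tuple of naturals.  Positions are 1-based, as in the
   mathematics, and the default 0 of [part] is only reached outside {1..n}. *)
Notation composition n := (n.-tuple nat).

Definition part n (eta : composition n) (i : nat) : nat := nth 0 eta i.-1.

Definition zero_comp n : composition n := [tuple 0 | _ < n].

(* Meaningful for 0 < i < n only. *)
Definition switch n (i : nat) (eta : composition n) : composition n :=
  [tuple part eta (if j.+1 == i then i.+1 else if j.+1 == i.+1 then i else j.+1)
    | j < n].

Definition raise n (eta : composition n) : composition n :=
  [tuple if j.+1 < n then part eta j.+2 else (part eta 1).+1 | j < n].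

(* The head of the list is applied first. *)
Definition switches n (l : seq nat) (eta : composition n) : composition n :=
  foldl (fun mu i => switch i mu) eta l.

Definition comp_max n (eta : composition n) : nat := \max_(j < n) tnth eta j.

Definition decreasing n (eta : composition n) : composition n :=
  [tuple of sort geq eta].

Definition reverse n (eta : composition n) : composition n :=
  [tuple of rev eta].

Definition lcount n (eta : composition n) (i : nat) : nat :=
  #|[set j : 'I_n | tnth eta j < i]|.

Definition gcount n (eta : composition n) (i : nat) : nat :=
  #|[set j : 'I_n | i <= tnth eta j]|.

(* [rev (iota m l)] is the decreasing list l + m - 1, ..., m. *)
Definition sigma n (eta : composition n) (i : nat) : seq nat :=
  if i <= 1 then [::]
  else flatten [seq rev (iota m (lcount eta i.-1)) | m <- iota 1 (gcount eta i)].

Definition last_pos n (eta mu : composition n) (i : nat) : nat :=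
  \max_(1 <= j < i.+1 | part mu j == part eta i) j.

(* Empty when p = i. *)
Definition climb (p i : nat) : seq nat := iota p (i - p).

(* [arranged eta k] is (eta^+)^R after the first k blocks, those of indices
   n, n - 1, ..., n - k + 1, have acted in this order. *)
Fixpoint arranged n (eta : composition n) (k : nat) : composition n :=
  if k is k'.+1 then
    let mu := arranged eta k' in
    switches (climb (last_pos eta mu (n - k')) (n - k')) mu
  else reverse (decreasing eta).

Definition p_index n (eta : composition n) (i : nat) : nat :=
  last_pos eta (arranged eta (n - i)) i.

Definition sigma' n (eta : composition n) (i : nat) : seq nat :=
  climb (p_index eta i) i.

Definition Rseq n (eta : composition n) : seq nat :=
  flatten [seq sigma eta i ++ nseq (gcount eta i) 0 | i <- iota 1 (comp_max eta)]
  ++ flatten [seq sigma' eta i | i <- rev (iota 2 n.-1)].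

(* Only the members U i with 0 < i < n are relevant. *)
Definition RG n (K : fieldType)
    (U : nat -> {mpoly K[n]} -> composition n -> {mpoly K[n]})
    (V : {mpoly K[n]} -> composition n -> {mpoly K[n]})
    (f : {mpoly K[n]}) (mu : composition n) (i : nat)
    : {mpoly K[n]} * composition n :=
  if i == 0 then (V f mu, raise mu) else (U i f mu, switch i mu).

Definition RG_run n (K : fieldType)
    (U : nat -> {mpoly K[n]} -> composition n -> {mpoly K[n]})
    (V : {mpoly K[n]} -> composition n -> {mpoly K[n]}) (l : seq nat)
    : {mpoly K[n]} * composition n :=
  foldl (fun x i => RG U V x.1 x.2 i) (1%R, zero_comp n) l.

(* Main.v *)
Require Import Defs.
From HB Require Import structures.
From mathcomp Require Import all_boot all_order all_algebra.
From mathcomp Require Import mpoly.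
From mathcomp Require Import zify.
Set Implicit Arguments.
Unset Strict Implicit.
Unset Printing Implicit Defensive.
Local Open Scope nat_scope.

(** Each letter of the sequence acts on polynomials as it acts on compositions,
    so the run always holds a pair [(F mu, mu)] as long as its letters are
    smaller than [n] ([RG_run_steps]).  What has to be shown is therefore purely
    combinatorial: the letters of [Rseq eta], applied in order, transform the
    zero composition into [eta].

    The first half of the word builds the nondecreasing rearrangement [s] of
    [eta] level by level: after stage [k] the composition is [s] with every
    part truncated at [k] ([tval_stages]).  Before stage [k + 1] it has the
    form [A ++ k ... k ++ k ... k], where [A] contains the parts smaller than
    [k] and the last block stands for the parts of [s] larger than [k].
    The switches of [sigma] bring as many copies of [k] as that block has to
    the front, past [A]; raising them one at a time turns each into [k + 1] and
    sends it to the back ([tval_stage]).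

    The second half sorts in place, from right to left.  At position [i], the
    parts to the right of [i] are already those of [eta], so the first [i]
    parts are a rearrangement of the first [i] parts of [eta], and the value
    wanted at [i] is found at some position [p <= i].  Switching it upwards
    from [p] to [i] keeps everything to the right of [i] ([arrangedP]).  When
    only the first position is left, there is nothing more to choose
    ([arranged_full]). *)

(** * Runs of the algorithm as words of operators *)

Definition step n (mu : composition n) (i : nat) : composition n :=
  if i == 0 then raise mu else switch i mu.

Definition steps n (l : seq nat) (mu : composition n) : composition n :=
  foldl (@step n) mu l.

Lemma steps_cat n l1 l2 (mu : composition n) :
  steps (l1 ++ l2) mu = steps l2 (steps l1 mu).
Proof. exact: foldl_cat. Qed.

Lemma switches_cat n l1 l2 (mu : composition n) :
  switches (l1 ++ l2) mu = switches l2 (switches l1 mu).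
Proof. exact: foldl_cat. Qed.

Lemma steps_switches n l (mu : composition n) :
  all (leq 1) l -> steps l mu = switches l mu.
Proof.
elim: l mu => //= i l IH mu /andP[i_gt0 l_gt0].
by rewrite -[LHS]/(steps l (step mu i)) IH // /step eqn0Ngt i_gt0.
Qed.

(** The pairs [(F mu, mu)] are preserved by every letter smaller than [n], and
    the initial pair is one of them because [F] is 1 at the zero composition. *)
Lemma RG_run_steps n (K : fieldType) (F : composition n -> {mpoly K[n]}) U V l :
  F (zero_comp n) = 1%R ->
  (forall mu i, 1 <= i <= n.-1 -> U i (F mu) mu = F (switch i mu)) ->
  (forall mu, V (F mu) mu = F (raise mu)) ->
  all (gtn n) l ->
  RG_run U V l = (F (steps l (zero_comp n)), steps l (zero_comp n)).
Proof.
move=> F0 HU HV; rewrite /RG_run -F0.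
elim: l (zero_comp n) => //= i l IH mu /andP[lt_i_n l_n].
rewrite -[X in _ = (F X, X)]/(steps l (step mu i)) -IH //; congr foldl.
rewrite /RG /step /=; case: eqP => [_|i_neq0]; first by rewrite HV.
by rewrite HU //; move: lt_i_n => /=; lia.
Qed.

(** * Effect of the operators on the list of parts *)

Lemma tval_switch n (mu : composition n) a x y b :
  tval mu = a ++ x :: y :: b ->
  tval (switch (size a).+1 mu) = a ++ y :: x :: b.
Proof.
move=> mu_eq; have := size_tuple mu; rewrite mu_eq size_cat /= => /esym sz_n.
apply: (@eq_from_nth _ 0); first by rewrite size_tuple card_ord size_cat.
move=> j; rewrite size_tuple card_ord => lt_j_n.
rewrite -[j in LHS]/(val (Ordinal lt_j_n)) nth_mktuple /part mu_eq /=.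
rewrite !eqSS !nth_cat.
have [->|neq_a] := eqVneq j (size a).
  by rewrite /= ltnn subnn ltnNge leqnSn /= subSnn.
have [->|neq_a1] := eqVneq j (size a).+1.
  by rewrite /= ltnn subnn ltnNge leqnSn /= subSnn.
rewrite /=; case: ltnP => // le_a_j.
have -> : j - size a = (j - size a).-2.+2 by lia.
by [].
Qed.

Lemma tval_raise n (mu : composition n) x s :
  tval mu = x :: s -> tval (raise mu) = rcons s x.+1.
Proof.
move=> mu_eq; have := size_tuple mu; rewrite mu_eq /= => sz_n.
apply: (@eq_from_nth _ 0); first by rewrite size_tuple card_ord size_rcons sz_n.
move=> j; rewrite size_tuple card_ord => lt_j_n.
rewrite -[j in LHS]/(val (Ordinal lt_j_n)) nth_mktuple /part mu_eq /=.
rewrite nth_rcons -sz_n ltnS; case: ltnP => // le_s_j.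
by have -> : j == size s by lia.
Qed.

(** Consecutive increasing switches carry one part to the right across a block,
    each switch acting on the place that the previous one moved it to. *)
Lemma tval_climb n (mu : composition n) a x b c :
  tval mu = a ++ x :: b ++ c ->
  tval (switches (climb (size a).+1 ((size a).+1 + size b)) mu)
    = a ++ b ++ x :: c.
Proof.
rewrite /climb addKn; elim: b a mu => [|y b IH] a mu mu_eq //=.
have := IH (rcons a y) (switch (size a).+1 mu).
by rewrite size_rcons !cat_rcons; apply; apply: tval_switch.
Qed.

(** The mirror image of [tval_climb]: decreasing switches carry a part to the
    left. *)
Lemma tval_descend n (mu : composition n) a b x c :
  tval mu = a ++ b ++ x :: c ->
  tval (switches (rev (iota (size a).+1 (size b))) mu) = a ++ x :: b ++ c.
Proof.
elim/last_ind: b x c mu => [|b y IH] x c mu mu_eq //.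
rewrite size_rcons -[(size b).+1]addn1 iotaD rev_cat switches_cat.
rewrite cat_rcons; apply: IH.
have -> : (size a).+1 + size b = (size (a ++ b)).+1 by rewrite size_cat.
rewrite catA; apply: tval_switch; by rewrite mu_eq cat_rcons catA.
Qed.

(** The parts of [d] cross the block [b] one by one, leftmost first; each one
    that has crossed moves the block one place to the right, which is why the
    starting index [m] grows by one. *)
Lemma tval_exchange n (mu : composition n) a b d c :
  tval mu = a ++ b ++ d ++ c ->
  tval (switches (flatten [seq rev (iota m (size b))
                             | m <- iota (size a).+1 (size d)]) mu)
    = a ++ d ++ b ++ c.
Proof.
elim: d a mu => [|x d IH] a mu mu_eq //=; rewrite switches_cat.
have := IH (rcons a x) (switches (rev (iota (size a).+1 (size b))) mu).
by rewrite size_rcons !cat_rcons; apply; apply: tval_descend.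
Qed.

(** Raising sends the first part to the end, so repeated raising rotates the
    front block to the back and adds one to each of its members. *)
Lemma tval_raises n (mu : composition n) a b :
  tval mu = a ++ b ->
  tval (steps (nseq (size a) 0) mu) = b ++ map S a.
Proof.
elim: a b mu => [|x a IH] b mu mu_eq /=; first by rewrite cats0.
rewrite -cat_rcons; apply: IH.
by rewrite -rcons_cat; apply: tval_raise.
Qed.

(** * Building the nondecreasing rearrangement *)

Lemma lcount_count n (eta : composition n) i :
  lcount eta i = count (gtn i) eta.
Proof.
rewrite /lcount -sum1_card -sum1_count big_tuple.
by apply: eq_bigl => j; rewrite inE.
Qed.

Lemma gcount_count n (eta : composition n) i :
  gcount eta i = count (leq i) eta.
Proof.
rewrite /gcount -sum1_card -sum1_count big_tuple.
by apply: eq_bigl => j; rewrite inE.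
Qed.

Lemma sorted_filter_split k s :
  sorted leq s -> filter (gtn k) s ++ filter (leq k) s = s.
Proof.
elim: s => //= x s IH x_s.
have /IH s_eq := path_sorted x_s.
have [lt_x_k|le_k_x] := ltnP x k; first by rewrite /= s_eq.
have k_s : all (leq k) s.
  apply: sub_all (order_path_min leq_trans x_s) => y; exact: leq_trans.
rewrite (all_filterP k_s) (eq_in_filter (a2 := pred0)) ?filter_pred0 //.
by move=> y /(allP k_s) /=; rewrite ltnNge => ->.
Qed.

Lemma map_const_nseq (T : eqType) (f : T -> nat) x s :
  {in s, forall y, f y = x} -> map f s = nseq (size s) x.
Proof.
elim: s => //= y s IH fx; rewrite fx ?mem_head // IH // => z z_s.
by rewrite fx // inE z_s orbT.
Qed.

(** No part is smaller than 0, so the formula for [sigma] in terms of descending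
    runs yields only empty runs at level 1, in agreement with the convention
    that this level has no switches.  All levels can then be treated alike. *)
Lemma sigma_uniform n (eta : composition n) k :
  sigma eta k.+1 =
    flatten [seq rev (iota m (lcount eta k)) | m <- iota 1 (gcount eta k.+1)].
Proof.
case: k => [|k //]; rewrite /sigma lcount_count (eq_count (a2 := pred0)) //.
by rewrite count_pred0 /=; elim: (iota _ _).
Qed.

(** Split [s] into its parts [A] below [k], [B] equal to [k] and [C] above [k].
    Truncated at [k], the last two blocks consist of copies of [k], so the
    switches may move any [size C] of these copies to the front before they
    are raised. *)
Lemma tval_stage n (eta mu : composition n) k :
  tval mu = map (minn k) (sort leq eta) ->
  tval (steps (sigma eta k.+1 ++ nseq (gcount eta k.+1) 0) mu)
    = map (minn k.+1) (sort leq eta).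
Proof.
set s := sort leq eta => mu_eq.
have s_sorted : sorted leq s := sort_sorted leq_total eta.
have cnt p : count p eta = count p s by rewrite /s count_sort.
have s_eq := sorted_filter_split k s_sorted.
set A := filter (gtn k) s in s_eq.
pose r := filter (leq k) s.
have r_sorted : sorted leq r by apply: sorted_filter => //; exact: leq_trans.
have r_eq := sorted_filter_split k.+1 r_sorted.
set B := filter (gtn k.+1) r in r_eq; set C := filter (leq k.+1) r in r_eq.
rewrite -/r -r_eq in s_eq.
have lA : lcount eta k = size A by rewrite lcount_count cnt -size_filter.
have gC : gcount eta k.+1 = size C.
  rewrite gcount_count cnt -size_filter /C /r -filter_predI.
  by congr size; apply: eq_filter => x /=; lia.
have Alt x : x \in A -> x < k by rewrite mem_filter => /andP[].
have Beq x : x \in B -> x = k by rewrite !mem_filter /= => /and3P[]; lia.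
have Cge x : x \in C -> k < x by rewrite mem_filter => /andP[].
have minA j : k <= j -> map (minn j) A = A.
  move=> le_kj; rewrite -[RHS]map_id; apply/eq_in_map => x /Alt; lia.
have minB j : k <= j -> map (minn j) B = nseq (size B) k.
  move=> le_kj; apply: map_const_nseq => x /Beq; lia.
have minC j : j <= k.+1 -> map (minn j) C = nseq (size C) j.
  move=> le_jk; apply: map_const_nseq => x /Cge; lia.
move: mu_eq; rewrite -s_eq !map_cat !minA // !minB // !minC // => mu_eq.
rewrite steps_cat sigma_uniform lA gC.
rewrite [in X in steps _ X]steps_switches; last first.
  apply/allP => i /flatten_mapP[m]; rewrite mem_iota mem_rev mem_iota /=.
  by lia.
(* Copies of [k] are interchangeable: the block that is moved is read as
   the first [size C] of them rather than the last. *)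
have {}mu_eq : tval mu = [::] ++ A ++ nseq (size C) k ++ nseq (size B) k.
  by rewrite mu_eq -!nseqD addnC.
have := tval_exchange mu_eq; rewrite /= size_nseq => /tval_raises.
by rewrite size_nseq map_nseq catA.
Qed.

(** Truncation at 0 gives the zero composition, the starting point. *)
Lemma tval_stages n (eta : composition n) k :
  tval (steps (flatten [seq sigma eta i ++ nseq (gcount eta i) 0
                          | i <- iota 1 k]) (zero_comp n))
    = map (minn k) (sort leq eta).
Proof.
elim: k => [|k IH].
  rewrite (@map_const_nseq _ _ 0 (sort _ _)); last first.
    by move=> x _; rewrite min0n.
  by rewrite size_sort size_tuple /= (@map_const_nseq _ _ 0) // size_enum_ord.
rewrite -{1}[k.+1]addn1 iotaD map_cat flatten_cat steps_cat /= cats0 add1n.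
exact: tval_stage.
Qed.

Lemma tval_reverse_decreasing n (eta : composition n) :
  tval (reverse (decreasing eta)) = sort leq eta.
Proof.
apply: (sorted_eq leq_trans anti_leq) => /=; last first.
- by rewrite perm_rev !perm_sort perm_sym perm_sort.
- exact: sort_sorted leq_total _.
rewrite rev_sorted; apply: sort_sorted => x y; exact: leq_total.
Qed.

(** Truncating at the largest part changes nothing, so that stage is the last. *)
Lemma steps_to_nondecreasing n (eta : composition n) :
  steps (flatten [seq sigma eta i ++ nseq (gcount eta i) 0
                    | i <- iota 1 (comp_max eta)]) (zero_comp n)
    = reverse (decreasing eta).
Proof.
apply: val_inj; rewrite /= tval_stages -[RHS]/(tval _) tval_reverse_decreasing.
rewrite -[RHS]map_id; apply/eq_in_map => x.
rewrite mem_sort => /tnthP[j ->]; apply/minn_idPr.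
exact: (leq_bigmax (F := tnth eta)).
Qed.

(** * Moving each part to its place *)

Lemma bigmax_mem_filter (P : pred nat) s :
  has P s -> \max_(j <- s | P j) j \in filter P s.
Proof.
elim: s => //= x s IH; rewrite big_cons.
have [/IH max_in _|/hasPn no_P /orP[Px|//]] := boolP (has P s).
  case: (P x) => //; rewrite inE /maxn; case: ltnP => _; last by rewrite eqxx.
  by rewrite max_in orbT.
rewrite Px big1_seq ?maxn0 ?mem_head // => j /andP[Pj j_s].
by have := no_P j j_s; rewrite Pj.
Qed.

(** The maximum that defines [last_pos] is 0 on an empty range; the hypothesis
    excludes this, so the maximum is attained. *)
Lemma last_posP n (eta mu : composition n) i :
  part eta i \in take i mu ->
  0 < last_pos eta mu i <= i /\ part mu (last_pos eta mu i) = part eta i.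
Proof.
move=> eta_in.
have idx_lt : index (part eta i) (take i mu) < size (take i mu).
  by rewrite index_mem.
have idx_lt_i : index (part eta i) (take i mu) < i.
  by apply: leq_trans idx_lt _; rewrite size_take_min geq_minl.
have /bigmax_mem_filter : has (fun j => part mu j == part eta i)
    (index_iota 1 i.+1).
  apply/hasP; exists (index (part eta i) (take i mu)).+1.
    by rewrite mem_index_iota; lia.
  by rewrite /part -(nth_take _ idx_lt_i) nth_index.
by rewrite mem_filter mem_index_iota ltnS => /andP[/eqP].
Qed.

(** Rearrangements of one another that agree beyond [i] are rearrangements of
    one another up to [i]. *)
Lemma part_in_take n (eta mu : composition n) i :
  0 < i <= n -> perm_eq mu eta -> drop i mu = drop i eta ->
  part eta i \in take i mu.
Proof.
move=> /andP[i_gt0 le_i_n] mu_perm mu_drop.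
have take_perm : perm_eq (take i mu) (take i eta).
  by rewrite -(perm_cat2r (drop i mu)) cat_take_drop mu_drop cat_take_drop.
rewrite (perm_mem take_perm) /part -[i in take i _](prednK i_gt0).
by rewrite (take_nth 0) ?mem_rcons ?mem_head // size_tuple; lia.
Qed.

(** The invariant of the right-to-left sort: still a rearrangement of [eta],
    with the last [k] parts already in place.  The rearrangement property is what
    guarantees that the next part to be placed is available. *)
Lemma arrangedP n (eta : composition n) k :
  k <= n ->
  perm_eq (arranged eta k) eta /\
  drop (n - k) (arranged eta k) = drop (n - k) eta.
Proof.
elim: k => [_|k IH lt_k_n].
  rewrite subn0 !drop_oversize ?size_tuple //; split=> //.
  by rewrite /arranged tval_reverse_decreasing perm_sort.
have [mu_perm mu_drop] := IH (ltnW lt_k_n).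
rewrite /=; set mu := arranged eta k in mu_perm mu_drop *.
set i := n - k in mu_drop *.
have i_gt0 : 0 < i by rewrite subn_gt0.
have le_i_n : i <= n by exact: leq_subr.
have eta_drop : drop i.-1 eta = part eta i :: drop i eta.
  by rewrite (drop_nth 0) ?prednK // size_tuple; lia.
have eta_in : part eta i \in take i mu.
  by apply: part_in_take; rewrite ?i_gt0.
have [/andP[p_gt0 le_p_i] mu_p] := last_posP eta_in.
move: (last_pos eta mu i) p_gt0 le_p_i mu_p => p p_gt0 le_p_i mu_p.
have [a [b [sz_a sz_b mu_eq]]] : exists a b, [/\ (size a).+1 = p,
    (size a).+1 + size b = i & tval mu = a ++ part eta i :: b ++ drop i eta].
  exists (take p.-1 mu), (take (i - p) (drop p mu)).
  have sz_a : size (take p.-1 mu) = p.-1.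
    by rewrite size_takel // size_tuple; lia.
  have sz_b : size (take (i - p) (drop p mu)) = i - p.
    by rewrite size_takel // size_drop size_tuple; lia.
  rewrite sz_a sz_b prednK // subnKC //; split=> //.
  rewrite -mu_drop -mu_p -[in X in _ ++ drop X _](subnK le_p_i) -drop_drop.
  rewrite cat_take_drop /part -[p in drop p _](prednK p_gt0) -drop_nth.
    by rewrite cat_take_drop.
  by rewrite size_tuple; lia.
have := tval_climb mu_eq; rewrite sz_b sz_a => ->.
have -> : n - k.+1 = i.-1 by rewrite subnS.
split; last first.
  rewrite eta_drop catA drop_size_cat // size_cat; lia.
by rewrite (perm_trans _ mu_perm) // mu_eq perm_cat2l -cat1s perm_catCA.
Qed.

(** After [n - 1] steps at most one part is unsettled, and a list of length at
    most 1 is determined by its rearrangements. *)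
Lemma arranged_full n (eta : composition n) : arranged eta n.-1 = eta.
Proof.
have [] := @arrangedP n eta n.-1 (leq_pred n).
move: (arranged _ _) => mu mu_perm mu_drop; apply: val_inj => /=.
have sz_take : size (take (n - n.-1) eta) <= 1.
  by rewrite size_take_min size_tuple; lia.
rewrite -(cat_take_drop (n - n.-1) mu) -[in RHS](cat_take_drop (n - n.-1) eta).
rewrite mu_drop; congr (_ ++ _); apply: perm_small_eq => //.
rewrite -(perm_cat2r (drop (n - n.-1) mu)) cat_take_drop mu_drop.
by rewrite cat_take_drop.
Qed.

Lemma switches_sigma' n (eta : composition n) k :
  k <= n ->
  switches (flatten [seq sigma' eta i | i <- rev (iota (n - k).+1 k)])
    (reverse (decreasing eta)) = arranged eta k.
Proof.
elim: k => // k IH lt_k_n.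
have -> : (n - k.+1).+1 = n - k by lia.
rewrite -[iota _ _]/((n - k) :: iota (n - k).+1 k) rev_cons map_rcons.
rewrite flatten_rcons switches_cat IH ?(ltnW lt_k_n) //=.
by rewrite /sigma' /p_index subKn ?(ltnW lt_k_n).
Qed.

(** * The whole sequence *)

(** The parts below [k] and those above [k] are disjoint families; this is the
    bound that keeps the indices in [sigma] below [n]. *)
Lemma count_le_tuple n (eta : composition n) k :
  lcount eta k + gcount eta k.+1 <= n.
Proof.
rewrite lcount_count gcount_count -[leqRHS](size_tuple eta).
rewrite -(count_predC (gtn k)).
by rewrite leq_add2l; apply: sub_count => x /=; lia.
Qed.

Lemma Rseq_lt n (eta : composition n) : 0 < n -> all (gtn n) (Rseq eta).
Proof.
move=> n_gt0; apply/allP => i; rewrite mem_cat => /orP[] /flatten_mapP[k].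
  rewrite mem_iota mem_cat => /andP[k_gt0 _] /orP[|/nseqP[-> //]].
  rewrite -(prednK k_gt0) sigma_uniform => /flatten_mapP[m].
  rewrite mem_iota mem_rev mem_iota => m_le i_le.
  have := count_le_tuple eta k.-1; rewrite /=; lia.
rewrite mem_rev mem_iota /sigma' /climb mem_iota /=; lia.
Qed.

(** Positivity of [p_index] ensures that no letter of [sigma'] is 0, the code of
    the raising operator. *)
Lemma p_index_gt0 n (eta : composition n) i :
  0 < i <= n -> 0 < p_index eta i.
Proof.
move=> i_in; have /andP[_ le_i_n] := i_in.
have [mu_perm mu_drop] := arrangedP eta (leq_subr i n).
rewrite subKn // in mu_drop.
by have [/andP[]] := last_posP (part_in_take i_in mu_perm mu_drop).
Qed.

Theorem proposition2 (n : nat) (n_ge1 : 1 <= n) (K : fieldType)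
  (F : composition n -> {mpoly K[n]})
  (U : nat -> {mpoly K[n]} -> composition n -> {mpoly K[n]})
  (V : {mpoly K[n]} -> composition n -> {mpoly K[n]})
  (F0 : F (zero_comp n) = 1%R)
  (HU : forall (mu : composition n) (i : nat), 1 <= i <= n.-1 ->
          U i (F mu) mu = F (switch i mu))
  (HV : forall mu : composition n, V (F mu) mu = F (raise mu))
  (eta : composition n) :
  (RG_run U V (Rseq eta)).1 = F eta.
Proof.
rewrite (RG_run_steps F0 HU HV (Rseq_lt eta n_ge1)) /=; congr F.
rewrite steps_cat steps_to_nondecreasing steps_switches.
  rewrite -[RHS]arranged_full -switches_sigma' ?leq_pred //.
  (* The indices n, ..., 2 are those of the first [n - 1] rearranging steps. *)
  by have -> : (n - n.-1).+1 = 2 by lia.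
apply/allP => i /flatten_mapP[k]; rewrite mem_rev mem_iota => k_le.
rewrite /sigma' /climb mem_iota => /andP[+ _]; apply: leq_trans.
apply: p_index_gt0; lia.
Qed.
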